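(* Let $\mathcal{P}_A$ be an arrow space satisfying Axioms 1, 2, 4, 5 stated in the context. Let $\{P_i\}_{i=1}^n$ be a family of distinct points in $\mathcal{P}$, let $O\in\mathcal{P}$ be a point, and let $\{\lambda_i\}_{i=1}^n$ be real numbers with $\sum_{i=1}^n\lambda_i=1$. Then there exists a unique point $M\in\mathcal{P}$ such that $\sum_{i=1}^n[(\lambda_i)\overrightarrow{OP_i}]=[\overrightarrow{OM}]$ (sum with respect to $+_V$). Moreover $M$ is independent of the choice of $O$: if $\tilde O\in\mathcal{P}$ is any other point and $\sum_{i=1}^n[(\lambda_i)\overrightarrow{\tilde OP_i}]=[\overrightarrow{\tilde OL}]$, then $L=M$.
   Context: Let $\mathcal{P}$ be an infinite set whose elements are called points. An arrow is an ordered pair of points $\overrightarrow{AB}=(A,B)$ (tail $A$, head $B$; $A=B$ is allowed). The arrow space $\mathcal{P}_A$ is the set of all arrows; two arrows are equal iff they have the same tail and the same head. Negation: $-\overrightarrow{AB}=\overrightarrow{BA}$. Arrow addition is the partial operation $\overrightarrow{AB}+_A\overrightarrow{BC}=\overrightarrow{AC}$, defined exactly when the head of the first arrow equals the tail of the second. Axiom 1: there is a given map (arrow pre-inner product) $\langle -,-\rangle_A:\mathcal{P}_A\times\mathcal{P}_A\to\mathbb{R}$ such that for all points: $\langle\overrightarrow{AB},\overrightarrow{AB}\rangle_A\ge 0$, with equality iff $A=B$; $\langle\overrightarrow{AB},\overrightarrow{CD}\rangle_A=\langle\overrightarrow{CD},\overrightarrow{AB}\rangle_A$; $\langle\overrightarrow{AB}+_A\overrightarrow{BC},\overrightarrow{LM}\rangle_A=\langle\overrightarrow{AB},\overrightarrow{LM}\rangle_A+\langle\overrightarrow{BC},\overrightarrow{LM}\rangle_A$;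 $\langle-\overrightarrow{AB},\overrightarrow{CD}\rangle_A=-\langle\overrightarrow{AB},\overrightarrow{CD}\rangle_A$. Measure: $\|\overrightarrow{AB}\|_A=\sqrt{\langle\overrightarrow{AB},\overrightarrow{AB}\rangle_A}$. Scalar multiplication of arrows: for $t\in\mathbb{R}$, if $A=B$ or $t=0$ then $(t)\overrightarrow{AB}=\overrightarrow{AA}$. If $A\ne B$ and $t\neq0$ then $(t)\overrightarrow{AB}=\overrightarrow{AD}$, where $D\in\mathcal{P}$ is a point (assumed to exist) with $\|\overrightarrow{AD}\|_A=|t|\,\|\overrightarrow{AB}\|_A$ and $\langle\overrightarrow{AB},\overrightarrow{AD}\rangle_A=\|\overrightarrow{AB}\|_A\|\overrightarrow{AD}\|_A$ if $t>0$, $=-\|\overrightarrow{AB}\|_A\|\overrightarrow{AD}\|_A$ if $t<0$. Axiom 2: $\langle(t)\overrightarrow{AB},\overrightarrow{CD}\rangle_A=t\langle\overrightarrow{AB},\overrightarrow{CD}\rangle_A$ for all arrows and all $t\in\mathbb{R}$. Relation $\Re$ on $\mathcal{P}_A$: $\overrightarrow{AB}\;\Re\;\overrightarrow{CD}$ iff either $A=B$ and $C=D$, or ($A\ne B$, $C\neq D$ and) $\|\overrightarrow{AB}\|_A=\|\overrightarrow{CD}\|_A$ and $\frac{\langle\overrightarrow{AB},\overrightarrow{CD}\rangle_A}{\|\overrightarrow{AB}\|_A\|\overrightarrow{CD}\|_A}=1$. Axiom 4: if $\overrightarrow{AB}\;\Re\;\overrightarrow{CD}$ and $\overrightarrow{EF}\;\Re\;\overrightarrow{GH}$,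 then $\langle\overrightarrow{AB},\overrightarrow{EF}\rangle_A=\langle\overrightarrow{CD},\overrightarrow{GH}\rangle_A$. (Then $\Re$ is an equivalence relation.) Axiom 5: for $A\neq B$ and any point $P$, there is a unique point $K$ with $\overrightarrow{AB}\;\Re\;\overrightarrow{PK}$ and a unique point $K'$ with $\overrightarrow{AB}\;\Re\;\overrightarrow{K'P}$. (For $A=B$ the same holds with $K=K'=P$.) Vectors: $\mathcal{P}_v$ is the set of $\Re$-equivalence classes $[\overrightarrow{AB}]$. Vector addition: given $[\overrightarrow{AB}],[\overrightarrow{CD}]$, choose any point $P$, let $K,L$ be the unique points with $\overrightarrow{KP}\;\Re\;\overrightarrow{AB}$ and $\overrightarrow{PL}\;\Re\;\overrightarrow{CD}$, and set $[\overrightarrow{AB}]+_V[\overrightarrow{CD}]=[\overrightarrow{KP}+_A\overrightarrow{PL}]=[\overrightarrow{KL}]$; this is well defined (independent of $P$ and of the representatives), and with the vector scalar multiplication $t\,[\overrightarrow{AB}]=[(t)\overrightarrow{AB}]$ it makes $\mathcal{P}_v$ a real vector space. *)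

(* Defs.v *)
From HB Require Import structures.
From mathcomp Require Import all_boot all_order all_algebra.
From mathcomp Require Import boolp classical_sets cardinality reals.
Set Implicit Arguments.
Unset Strict Implicit.
Unset Printing Implicit Defensive.
Import Order.TTheory GRing.Theory Num.Theory.
Local Open Scope ring_scope.
Local Open Scope classical_set_scope.
Local Open Scope quotient_scope.

(* The arrow from A to B is the pair (A, B): tail first, head second. *)
Notation arrow T := (T * T)%type.

Definition nega (T : Type) (a : arrow T) : arrow T := (a.2, a.1).

(* Partial: None unless the head of a is the tail of b. *)
Definition adda (T : eqType) (a b : arrow T) : option (arrow T) :=
  if a.2 == b.1 then Some (a.1, b.2) else None.

Record preArrowSpace (R : realType) := PreArrowSpace {
  point :> choiceType;
  point_infinite : infinite_set [set: point];
  ip : arrow point -> arrow point -> R;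
  ip_ge0 : forall a, 0 <= ip a a;
  ip_eq0 : forall a, ip a a = 0 <-> a.1 = a.2;
  ipC : forall a b, ip a b = ip b a;
  ipD : forall a b c d, adda a b = Some c -> ip c d = ip a d + ip b d;
  ipN : forall a b, ip (nega a) b = - ip a b
}.

Section PreArrowSpaceDefs.
Variables (R : realType) (S : preArrowSpace R).
Implicit Types (a b : arrow S) (t : R).

Definition norma a : R := Num.sqrt (ip a a).

(* D is an admissible head for (t)a, when a is nondegenerate and t != 0. *)
Definition is_scaled_head t a (D : S) : Prop :=
  norma (a.1, D) = `|t| * norma a /\
  ip a (a.1, D) = if 0 < t then norma a * norma (a.1, D)
                  else - (norma a * norma (a.1, D)).

(* The default value a.1 of xget is never used: the structure arrowSpace below
   assumes the existence of an admissible head. *)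
Definition scalea t a : arrow S :=
  if (a.1 == a.2) || (t == 0) then (a.1, a.1)
  else (a.1, xget a.1 [set D | is_scaled_head t a D]).

Definition arel : rel (arrow S) := fun a b =>
  ((a.1 == a.2) && (b.1 == b.2)) ||
  [&& a.1 != a.2, b.1 != b.2, norma a == norma b
    & ip a b / (norma a * norma b) == 1].

End PreArrowSpaceDefs.

Record arrowSpace (R : realType) := ArrowSpace {
  arrow_base :> preArrowSpace R;
  scaled_head_ex : forall (t : R) (a : arrow arrow_base),
    a.1 <> a.2 -> t <> 0 -> exists D, is_scaled_head t a D;
  ipZ : forall (t : R) (a b : arrow arrow_base),
    ip (scalea t a) b = t * ip a b;
  ip_arel : forall a b c d : arrow arrow_base,
    arel a b -> arel c d -> ip a c = ip b d;
  arel_head_ex : forall (a : arrow arrow_base) (P : arrow_base),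
    a.1 <> a.2 -> exists! K, arel a (P, K);
  arel_tail_ex : forall (a : arrow arrow_base) (P : arrow_base),
    a.1 <> a.2 -> exists! K, arel a (K, P)
}.

Section Vectors.
Variables (R : realType) (S : arrowSpace R).
Implicit Types (a b c d : arrow S) (A B C K L P : S) (t : R).

Lemma ip_chasles A B C d : ip (A, C) d = ip (A, B) d + ip (B, C) d.
Proof. by apply: ipD; rewrite /adda /= eqxx. Qed.

Lemma ip_nilr a A : ip a (A, A) = 0.
Proof.
apply: (@addrI _ (ip (A, A) a)).
by rewrite [ip a _]ipC -ip_chasles addr0.
Qed.

Lemma ip_nill a A : ip (A, A) a = 0.
Proof. by rewrite ipC ip_nilr. Qed.

Lemma norma_neq0 a : a.1 != a.2 -> norma a != 0.
Proof.
move=> na; rewrite /norma sqrtr_eq0 -ltNge lt_neqAle ip_ge0 andbT eq_sym.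
by apply: contra na => /eqP /ip_eq0 ->.
Qed.

Lemma sqr_norma a : norma a * norma a = ip a a.
Proof. by rewrite -expr2 sqr_sqrtr // ip_ge0. Qed.

Lemma arel_refl : reflexive (@arel R S).
Proof.
move=> a; rewrite /arel; case: eqVneq => //= na.
by rewrite eqxx -sqr_norma divff ?eqxx // mulf_neq0 // norma_neq0.
Qed.

Lemma arelP a b : reflect (forall c, ip a c = ip b c) (arel a b).
Proof.
apply: (iffP idP) => [ab c|ab]; first exact: ip_arel ab (arel_refl c).
have eab : ip a a = ip b b by rewrite ab ipC ab.
have nab : norma a = norma b by rewrite /norma eab.
have e12 : (a.1 == a.2) = (b.1 == b.2).
  apply/eqP/eqP => /ip_eq0 h; apply/ip_eq0; first by rewrite -eab.
  by rewrite eab.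
rewrite /arel -e12; case: eqVneq => //= na.
rewrite -nab eqxx sqr_norma ipC -ab divff ?eqxx //.
by rewrite -sqr_norma mulf_neq0 // norma_neq0.
Qed.

Lemma arel_sym : symmetric (@arel R S).
Proof. by move=> a b; apply/arelP/arelP => h c; rewrite h. Qed.

Lemma arel_trans : transitive (@arel R S).
Proof. by move=> b a c /arelP ab /arelP bc; apply/arelP => d; rewrite ab. Qed.

Canonical arel_equiv := EquivRel (@arel R S) arel_refl arel_sym arel_trans.

Definition vector := {eq_quot (@arel R S)}.

HB.instance Definition _ : EqQuotient _ (@arel R S) vector := EqQuotient.on vector.
HB.instance Definition _ := Choice.on vector.

Definition vec (a : arrow S) : vector := \pi_vector a.

Lemma eq_vec a b : vec a = vec b <-> arel a b.
Proof.
split=> [/eqP|ab]; first by rewrite /vec eqmodE.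
by apply/eqP; rewrite /vec eqmodE.
Qed.

Lemma vecP a b : vec a = vec b <-> forall c, ip a c = ip b c.
Proof. by split=> [/eq_vec/arelP|/arelP/eq_vec]. Qed.

Lemma vec_repr (u : vector) : vec (repr u) = u.
Proof. exact: reprK. Qed.

Lemma ip_repr a c : ip (repr (vec a)) c = ip a c.
Proof. by move: c; apply/vecP; rewrite vec_repr. Qed.

Lemma base_point_ex : exists P : S, True.
Proof.
by have [P _] := infinite_setN0 (@point_infinite _ S); exists P.
Qed.

Definition base_point : S := projT1 (cid base_point_ex).

Lemma arel_head a P : exists K, arel a (P, K).
Proof.
have [e|/eqP na] := eqVneq a.1 a.2; last by have [K []] := arel_head_ex P na; exists K.
by exists P; rewrite /arel e /= !eqxx.
Qed.

Lemma arel_tail a P : exists K, arel a (K, P).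
Proof.
have [e|/eqP na] := eqVneq a.1 a.2; last by have [K []] := arel_tail_ex P na; exists K.
by exists P; rewrite /arel e /= !eqxx.
Qed.

Definition zerov : vector := vec (base_point, base_point).

Definition oppv (u : vector) : vector := vec (nega (repr u)).

(* Independence of the junction point P and of the representatives is addv_vec. *)
Definition addv (u v : vector) : vector :=
  let P := base_point in
  let K := xget P [set K | arel (K, P) (repr u)] in
  let L := xget P [set L | arel (P, L) (repr v)] in
  vec (K, L).

Definition scalev t (u : vector) : vector := vec (scalea t (repr u)).

Lemma ip_addv u v c :
  ip (repr (addv u v)) c = ip (repr u) c + ip (repr v) c.
Proof.
rewrite ip_repr (ip_chasles _ base_point); congr (_ + _).
- have [K hK] := arel_tail (repr u) base_point.
  rewrite arel_sym in hK.
  have /arelP := @xgetI _ base_point [set K | arel (K, base_point) (repr u)] K hK.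
  exact.
- have [L hL] := arel_head (repr v) base_point.
  rewrite arel_sym in hL.
  have /arelP := @xgetI _ base_point [set L | arel (base_point, L) (repr v)] L hL.
  exact.
Qed.

Lemma addv_vec P K L a b : arel (K, P) a -> arel (P, L) b ->
  addv (vec a) (vec b) = vec (K, L).
Proof.
move=> /arelP ha /arelP hb; rewrite -[LHS]vec_repr; apply/vecP => c.
by rewrite ip_addv !ip_repr (ip_chasles _ P) ha hb.
Qed.

Lemma ip_oppv u c : ip (repr (oppv u)) c = - ip (repr u) c.
Proof. by rewrite ip_repr ipN. Qed.

Lemma ip_zerov c : ip (repr zerov) c = 0.
Proof. by rewrite ip_repr ip_nill. Qed.

Lemma ip_scalev t u c : ip (repr (scalev t u)) c = t * ip (repr u) c.
Proof. by rewrite ip_repr ipZ. Qed.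

Lemma scalev_vec t a : scalev t (vec a) = vec (scalea t a).
Proof. by apply/vecP => c; rewrite !ipZ ip_repr. Qed.

Let ipvE := (ip_addv, ip_oppv, ip_zerov, ip_scalev).

Lemma vector_ext (u v : vector) :
  (forall c, ip (repr u) c = ip (repr v) c) -> u = v.
Proof. by move=> h; rewrite -(vec_repr u) -(vec_repr v); apply/vecP. Qed.

Lemma addvA : associative addv.
Proof. by move=> u v w; apply: vector_ext => c; rewrite !ipvE addrA. Qed.

Lemma addvC : commutative addv.
Proof. by move=> u v; apply: vector_ext => c; rewrite !ipvE addrC. Qed.

Lemma add0v : left_id zerov addv.
Proof. by move=> u; apply: vector_ext => c; rewrite !ipvE add0r. Qed.

Lemma addNv : left_inverse zerov oppv addv.
Proof. by move=> u; apply: vector_ext => c; rewrite !ipvE addNr. Qed.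

HB.instance Definition _ := GRing.isZmodule.Build vector addvA addvC add0v addNv.

Lemma scalevA t s u : scalev t (scalev s u) = scalev (t * s) u.
Proof. by apply: vector_ext => c; rewrite !ipvE mulrA. Qed.

Lemma scale1v : left_id 1 scalev.
Proof. by move=> u; apply: vector_ext => c; rewrite !ipvE mul1r. Qed.

Lemma scalevDr : right_distributive scalev +%R.
Proof. by move=> t u v; apply: vector_ext => c; rewrite !ipvE mulrDr. Qed.

Lemma scalevDl u : {morph scalev^~ u : t s / t + s}.
Proof. by move=> t s; apply: vector_ext => c; rewrite !ipvE mulrDl. Qed.

HB.instance Definition _ :=
  GRing.Zmodule_isLmodule.Build R vector scalevA scale1v scalevDr scalevDl.

End Vectors.

(* Main.v *)
Require Import Defs.
From HB Require Import structures.
From mathcomp Require Import all_boot all_order all_algebra.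
From mathcomp Require Import boolp classical_sets cardinality reals.
Import Order.TTheory GRing.Theory Num.Theory.
Local Open Scope ring_scope.

(* The vectors satisfy Chasles' relation [AC] = [AB] + [BC]. As the weights sum
   to 1, moving the origin from O to O' adds [O'O] to the weighted sum, which
   is also the change from [OM] to [O'M]. *)

Lemma vec_chasles (R : realType) (S : arrowSpace R) (A B C : S) :
  vec (A, C) = vec (A, B) + vec (B, C).
Proof. exact/esym/addv_vec/arel_refl/arel_refl. Qed.

(** Equal classes pair equally with [(X, Y)], so by Chasles [(X, Y)] is orthogonal to itself, and
    definiteness gives [X = Y]. *)
Lemma vec_head_inj (R : realType) (S : arrowSpace R) (A : S) :
  injective (fun X : S => vec (A, X)).
Proof.
move=> X Y /vecP eXY.
suff /ip_eq0 : ip (X, Y) (X, Y) = 0 by [].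
by apply: (@addrI _ (ip (A, X) (X, Y))); rewrite -ip_chasles addr0 eXY.
Qed.

(** Together with [vec_head_inj], this identifies points with vectors once an origin is chosen. *)
Lemma vec_head_ex (R : realType) (S : arrowSpace R) (A : S) (u : vector S) :
  exists X : S, u = vec (A, X).
Proof.
have [X uX] := arel_head (repr u) A.
by exists X; rewrite -[LHS]vec_repr; apply/eq_vec.
Qed.

Lemma sum_vec_change_origin (R : realType) (S : arrowSpace R) (n : nat)
    (P : 'I_n -> S) (lambda : 'I_n -> R) (O O' : S) :
  \sum_(i < n) lambda i = 1 ->
  \sum_(i < n) vec (scalea (lambda i) (O', P i)) =
    vec (O', O) + \sum_(i < n) vec (scalea (lambda i) (O, P i)).
Proof.
(* Writing 1 as the sum of the weights spreads [vec (O', O)] over the indices, so the claim can be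
   checked term by term. *)
move=> sum1; rewrite -[vec (O', O)]scale1r -sum1 scaler_suml -big_split /=.
apply: eq_bigr => i _.
by rewrite -!scalev_vec (vec_chasles _ _ _ O); exact: scalerDr.
Qed.

Theorem theorem62 (R : realType) (S : arrowSpace R) (n : nat)
    (P : 'I_n -> S) (O : S) (lambda : 'I_n -> R)
    (P_distinct : injective P) (sum_lambda : \sum_(i < n) lambda i = 1) :
  exists M : S,
    unique (fun X : S =>
      \sum_(i < n) vec (scalea (lambda i) (O, P i)) = vec (O, X)) M /\
    forall O' L : S,
      \sum_(i < n) vec (scalea (lambda i) (O', P i)) = vec (O', L) -> L = M.
Proof.
have [M sumM] := vec_head_ex _ _ O
  (\sum_(i < n) vec (scalea (lambda i) (O, P i))).
exists M; split; first by split=> // X; rewrite sumM => /vec_head_inj.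
(* Seen from [O'], the weighted sum is [vec (O', O) + vec (O, M)], that is [vec (O', M)]. *)
move=> O' L; rewrite (sum_vec_change_origin _ _ _ _ _ O) // sumM -vec_chasles.
by move=> /vec_head_inj.
Qed.
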